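(* There is a function $f$ from the nonnegative integers to the positive reals such that the following holds. Let $\varepsilon>0$ and let $G$ be an $\varepsilon$-perturbed $2$-edge-colored graph on $n$ vertices with $n\ge\varepsilon^{-1/2}$. Then there exists $Z\subset V(G)$ with $|Z|\le (f(\alpha(G))+\alpha(G))\sqrt{\varepsilon}\,n$ such that $V(G)\setminus Z$ can be partitioned into at most $2\alpha(G)$ classes, where each class, in $G^-$, either is spanned by a connected monochromatic matching, or contains a monochromatic spanning cycle, or is the vertex set of an edge, or is a single vertex.
   Context: A graph $G$ on $n$ vertices is $\varepsilon$-perturbed if at most $\varepsilon\binom n2$ of its edges are marked as exceptional (perturbed). $G^-$ denotes the graph obtained from $G$ by removing all perturbed edges. $\alpha(G)$ is the independence number of $G$. A monochromatic connected matching in $G^-$ is a matching of edges of one color all lying in one connected component of the subgraph of $G^-$ formed by edges of that color; a class is spanned by it if the class is exactly the set of vertices covered by the matching. A monochromatic spanning cycle of a class is a cycle of $G^-$ with all edges of one color whose vertex set is the whole class. *)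

(* Defs.v *)
From mathcomp Require Import all_boot all_order all_algebra.
From mathcomp Require Import reals.

Set Implicit Arguments.
Unset Strict Implicit.
Unset Printing Implicit Defensive.

Import Order.TTheory GRing.Theory Num.Theory.

Local Open Scope ring_scope.

(* A finite simple graph with vertex type T is given by its edge set
   E : {set {set T}}, all of whose members have exactly two elements. *)
Definition simple_graph (T : finType) (E : {set {set T}}) : bool :=
  [forall a in E, #|a| == 2%N].

(* No loops when E is simple, since [set x; x] is a singleton. *)
Definition adj (T : finType) (E : {set {set T}}) : rel T :=
  fun x y => [set x; y] \in E.

Definition independent (T : finType) (E : {set {set T}}) (S : {set T}) : bool :=
  [forall x in S, forall y in S, ~~ adj E x y].

Definition independence_number (T : finType) (E : {set {set T}}) : nat :=
  (\max_(S : {set T} | independent E S) #|S|)%N.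

(* P is the set of perturbed edges. *)
Definition perturbed (R : realType) (eps : R) (T : finType)
    (E P : {set {set T}}) : Prop :=
  P \subset E /\ #|P|%:R <= eps * 'C(#|T|, 2)%:R.

Definition unperturbed (T : finType) (E P : {set {set T}}) : {set {set T}} :=
  E :\: P.

(* A 2-edge-coloring is a map c : {set T} -> bool; only its values on edges
   matter. *)
Definition color_class (T : finType) (E : {set {set T}}) (c : {set T} -> bool)
    (k : bool) : {set {set T}} :=
  [set a in E | c a == k].

(* For a simple graph, trivIset M says that the edges in M are pairwise
   disjoint, and cover M is the set of vertices covered by them.  The third
   clause puts M in the connected component of r in the graph of color k. *)
Definition mono_connected_matching (T : finType) (E : {set {set T}})
    (c : {set T} -> bool) (M : {set {set T}}) : Prop :=
  exists k : bool,
    [/\ M \subset color_class E c k,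
        trivIset M
      & exists r : T,
          cover M \subset [set y | connect (adj (color_class E c k)) r y]].

Definition spanned_by_matching (T : finType) (E : {set {set T}})
    (c : {set T} -> bool) (C : {set T}) : Prop :=
  exists M : {set {set T}}, mono_connected_matching E c M /\ cover M = C.

(* Cycles have at least three vertices; ucycle alone would also accept shorter
   sequences. *)
Definition mono_spanning_cycle (T : finType) (E : {set {set T}})
    (c : {set T} -> bool) (C : {set T}) : Prop :=
  exists (k : bool) (s : seq T),
    [/\ (2 < size s)%N, ucycle (adj (color_class E c k)) s
      & [set x in s] = C].

Definition good_class (T : finType) (E : {set {set T}})
    (c : {set T} -> bool) (C : {set T}) : Prop :=
  [\/ spanned_by_matching E c C,
      mono_spanning_cycle E c C,
      C \in E
    | exists x : T, C = [set x]].

(* Main.v *)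
(* Vertices of perturbed degree above sqrt eps * n are few and are discarded.
   Regard every other vertex as an edge joining its red component to its blue
   component in G^-: vertices forming a matching of this bipartite graph are
   pairwise nonadjacent in G^-, so a matching without perturbed pairs has size at
   most alpha, and a version of Konig's theorem that tolerates perturbed pairs
   gives at most alpha components S1 covering almost everything.  Fix a maximal
   matching M1 whose edges lie in components of S1.  For uncovered vertices with
   only one component in S1, take the other component as a label: vertices with
   distinct labels are nonadjacent in G^-, so at most alpha labels S2 account for
   almost all of them.  Extend M1 to a maximal matching with edges in S1 and S2;
   uncovered vertices with both components in S1 and S2 are independent in G^-,
   hence few.  The matching edges in each of the at most 2 * alpha components of
   S1 and S2 form one class. *)
Require Import Defs.
From mathcomp Require Import all_boot all_order all_algebra.
From mathcomp Require Import reals zify.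

Set Implicit Arguments.
Unset Strict Implicit.
Unset Printing Implicit Defensive.

Import Order.TTheory GRing.Theory Num.Theory.

Local Open Scope ring_scope.
Local Open Scope nat_scope.

(** * König's theorem for a bipartite graph whose edges are points *)

(** A point [v] stands for an edge from [r v] on one side to [b v] on the other; [A] and [B] are the
    two halves of a vertex cover. *)
Definition bip_cover (T I : finType) (r b : T -> I) (X : {set T}) (A B : {set I}) :=
  [forall v in X, (r v \in A) || (b v \in B)].

Definition cover_ge (T I : finType) (r b : T -> I) (t : nat) (X : {set T}) :=
  [forall A : {set I}, forall B : {set I}, bip_cover r b X A B ==> (t <= #|A| + #|B|)].

Lemma cover_geP (T I : finType) (r b : T -> I) t (X : {set T}) :
  reflect (forall A B, bip_cover r b X A B -> t <= #|A| + #|B|) (cover_ge r b t X).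
Proof.
apply: (iffP forallP) => [H A B c|H A]; first by have /forallP/(_ B)/implyP := H A; apply.
by apply/forallP => B; apply/implyP/H.
Qed.

Lemma cover_geC (T I : finType) (r b : T -> I) t : cover_ge r b t =1 cover_ge b r t.
Proof.
suff H (r' b' : T -> I) X : cover_ge r' b' t X -> cover_ge b' r' t X.
  by move=> X; apply/idP/idP; apply: H.
move/cover_geP => H; apply/cover_geP => A B /forall_inP c; rewrite addnC; apply: H.
by apply/forall_inP => v /c; rewrite orbC.
Qed.

(* If x != y share their r-value, covers of size < t of X minus x and of X minus y
   can be crossed (meet on one side, join on the other) into two covers of X, one
   of which has size < t. *)
Lemma minimal_cover_ge_inj (T I : finType) (r b : T -> I) t (X : {set T}) :
  minset (cover_ge r b t) X -> {in X &, injective r}.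
Proof.
move=> minXP x y xX yX rxy; apply/eqP/contraT => xNy.
have [/cover_geP geX minX] := minsetP minXP.
have drop z : z \in X -> exists A B, [/\ bip_cover r b (X :\ z) A B,
    #|A| + #|B| < t, r z \notin A & b z \notin B].
  move=> zX; have : ~~ cover_ge r b t (X :\ z).
    apply/negP => /minX/(_ (subD1set _ _))/setP/(_ z).
    by rewrite !inE eqxx zX.
  case/forallPn => A /forallPn[B]; rewrite negb_imply -ltnNge => /andP[c lt].
  exists A, B; split => //; apply/negP => h.
    suff /geX : bip_cover r b X A B by rewrite leqNgt lt.
    apply/forall_inP => v vX; have [->|vz] := eqVneq v z; first by rewrite h.
    by apply: (forall_inP c); rewrite !inE vz.
  suff /geX : bip_cover r b X A B by rewrite leqNgt lt.
  apply/forall_inP => v vX; have [->|vz] := eqVneq v z; first by rewrite h orbT.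
  by apply: (forall_inP c); rewrite !inE vz.
have [A1 [B1 [/forall_inP c1 lt1 rx1 bx1]]] := drop x xX.
have [A2 [B2 [/forall_inP c2 lt2 ry2 by2]]] := drop y yX.
have cov1 v : v \in X -> v != x -> (r v \in A1) || (b v \in B1).
  by move=> vX vx; apply: c1; rewrite !inE vx.
have cov2 v : v \in X -> v != y -> (r v \in A2) || (b v \in B2).
  by move=> vX vy; apply: c2; rewrite !inE vy.
have leC : t <= #|A1 :&: A2| + #|B1 :|: B2|.
  apply: geX; apply/forall_inP => v vX; rewrite !inE.
  have [vx|vx] := eqVneq v x.
    by have := cov2 x xX xNy; rewrite vx rxy (negPf ry2) /= => ->; rewrite !orbT.
  have [vy|vy] := eqVneq v y.
    have := cov1 y yX; rewrite eq_sym xNy -{1}rxy (negPf rx1) /= vy => -> //.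
    by rewrite orbT.
  by have := cov1 v vX vx; have := cov2 v vX vy;
    case: (r v \in A1); case: (r v \in A2); case: (b v \in B1); case: (b v \in B2).
(* The common value [r x = r y] covers both exceptional points at the cost of one element. The two
   crossed covers then have total size at most [2 * (t - 1) + 1], which is less than [2 * t]. *)
have leD : t <= #|r x |: (A1 :|: A2)| + #|B1 :&: B2|.
  apply: geX; apply/forall_inP => v vX; rewrite !inE.
  have [vx|vx] := eqVneq v x; first by rewrite vx eqxx.
  have [vy|vy] := eqVneq v y; first by rewrite vy rxy eqxx.
  by have := cov1 v vX vx; have := cov2 v vX vy; case: (r v == r x);
    case: (r v \in A1); case: (r v \in A2); case: (b v \in B1); case: (b v \in B2).
have := cardsUI A1 A2; have := cardsUI B1 B2.
have := cardsU1 (r x) (A1 :|: A2).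
by move: leC leD lt1 lt2; case: (_ \notin _) => /=; clear; lia.
Qed.

(** Take a minimum cover of [X] and a minimal [Y] inside [X] that still needs covers of that size.
    Minimality makes [Y] a matching, and since [r @: Y] alone covers [Y], it is large enough. *)
Lemma konig (T I : finType) (r b : T -> I) (X : {set T}) :
  exists (Y : {set T}) (A B : {set I}),
    [/\ Y \subset X, {in Y &, injective r}, {in Y &, injective b},
        bip_cover r b X A B & #|A| + #|B| <= #|Y|].
Proof.
pose wt (AB : {set I} * {set I}) := #|AB.1| + #|AB.2|.
have ctop : bip_cover r b X (setT, setT : {set I}).1 (setT : {set I}, setT).2.
  by apply/forall_inP => v _; rewrite !inE.
have [[A B] /= cAB minAB] :=
  @arg_minnP _ (setT, setT) (fun AB => bip_cover r b X AB.1 AB.2) wt ctop.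
have geX : cover_ge r b (#|A| + #|B|) X.
  by apply/cover_geP => A' B' c'; have := minAB (A', B') c'.
have [Y minY YX] := minset_exists geX.
have rinj := minimal_cover_ge_inj minY.
have binj : {in Y &, injective b}.
  apply: (@minimal_cover_ge_inj _ _ b r (#|A| + #|B|)).
  by rewrite -(minset_eq _ (cover_geC r b (#|A| + #|B|))).
exists Y, A, B; split => //.
have /minsetP[/cover_geP/(_ (r @: Y) set0)] := minY.
rewrite cards0 addn0 => le _; apply: leq_trans (leq_imset_card r Y); apply: le.
by apply/forall_inP => v vY; rewrite imset_f.
Qed.

(** * König's theorem in the presence of perturbed pairs *)

Section RobustKonig.
Variables (T I : finType) (P : {set {set T}}) (V : {set T}) (m : nat).
Variables (r b : T -> I).
Hypothesis irrP : forall v, ~~ adj P v v.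
Hypothesis degP : forall v, v \in V -> #|[set w | adj P v w]| < m.

Definition missed (S : {set I}) := [set v in V | (r v \notin S) && (b v \notin S)].

Lemma adj_sym (E : {set {set T}}) : symmetric (adj E).
Proof. by move=> x y; rewrite /adj setUC. Qed.

Lemma missed_sub (S S' : {set I}) : S \subset S' -> missed S' \subset missed S.
Proof.
move=> /subsetP sub; apply/subsetP => v; rewrite !inE => /and3P[-> nr nb] /=.
by rewrite (contra (sub _) nr) (contra (sub _) nb).
Qed.

(** Each point of [X] excludes itself and fewer than [m] perturbed neighbours, hence at most [m]
    points. *)
Lemma extend_independent (W X : {set T}) :
  X \subset V -> independent P X -> #|X| * m < #|W| ->
  exists v, [/\ v \in W, v \notin X & independent P (v |: X)].
Proof.
move=> /subsetP XV iX lt.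
pose N := \bigcup_(x in X) (x |: [set w | adj P x w]).
have leN : #|N| <= #|X| * m.
  rewrite /N -sum_nat_const; elim/big_rec2: _ => [|x n W' xX le]; first by rewrite cards0.
  have := degP (XV _ xX); have := cardsU1 x [set w | adj P x w].
  by have := cardsU (x |: [set w | adj P x w]) W'; case: (_ \notin _) => /=; lia.
have /subsetPn[v vW vN] : ~~ (W \subset N).
  by apply/negP => /subset_leq_card; lia.
have noP x : x \in X -> (v != x) && ~~ adj P x v.
  move=> xX; rewrite -negb_or; apply: contra vN => h.
  by apply/bigcupP; exists x; rewrite // !inE.
exists v; split => //.
  by apply/negP => /noP; rewrite eqxx.
apply/forall_inP => x /setU1P[->|xX]; apply/forall_inP => y /setU1P[->|yX] //.
- by rewrite adj_sym; case/andP: (noP y yX).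
- by case/andP: (noP x xX).
- by have /forall_inP/(_ x xX)/forall_inP/(_ y yX) := iX.
Qed.

(* The points of X are the queries of the bounded search tree for a vertex cover
   of size < k extending S0: such a cover must hit each query, and it determines a
   branch ending in a set that misses few points. *)
Lemma search_tree N k (S0 : {set I}) (X0 : {set T}) :
  X0 \subset V -> independent P X0 -> #|X0| + 2 ^ k <= N ->
  exists X : {set T}, [/\ X0 \subset X, X \subset V, independent P X,
    #|X| < #|X0| + 2 ^ k &
    forall S : {set I}, S0 \subset S -> #|S :\: S0| < k ->
      [disjoint X & missed S] -> #|missed S| <= N * m].
Proof.
elim: k S0 X0 => [|k IH] S0 X0 X0V iX0 leN; first by exists X0; split => //; lia.
have k2 : 0 < 2 ^ k by rewrite expn_gt0.
move: leN; rewrite expnS => leN.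
have [small|big] := leqP #|missed S0| (N * m).
  exists X0; split => //; first lia.
  by move=> S /missed_sub/subset_leq_card le _ _; apply: leq_trans le small.
(* [N] bounds the number of queries made in the whole tree, so a set missing more than [N * m]
   points always leaves room for one more. *)
have [|v [vW vX0 iX1]] := @extend_independent (missed S0) X0 X0V iX0.
  by apply: leq_ltn_trans big; rewrite leq_mul2r; apply/orP; right; lia.
have card1 : #|v |: X0| = #|X0|.+1 by rewrite cardsU1 vX0.
have /[!inE]/and3P[vV rv bv] := vW.
(* The two branches are explored one after the other, the second starting from the queries of the
   first, so that all queries together stay independent. One query and two subtrees of at most
   [2 ^ k - 1] queries give at most [2 ^ k.+1 - 1] new ones. *)
have [||X1 [sub1 X1V iX1' lt1 cov1]] := IH (r v |: S0) (v |: X0) _ iX1.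
- by rewrite subUset sub1set vV.
- by move: leN card1 k2; clear; lia.
have [|X2 [sub2 X2V iX2 lt2 cov2]] := IH (b v |: S0) X1 X1V iX1'.
  by move: leN lt1 card1; clear; lia.
exists X2; split => //.
- by apply: subset_trans sub2; apply: subset_trans sub1; apply: subsetUr.
- by move: lt1 lt2 card1; clear; lia.
move=> S S0S ltS dis.
have step s : s \in S -> s \notin S0 -> (s |: S0 \subset S) /\ #|S :\: (s |: S0)| < k.
  move=> sS sS0; split; first by rewrite subUset sub1set sS.
  move: ltS; rewrite (cardsD1 s) !inE sS sS0 /= add1n ltnS.
  by rewrite setDDl setUC.
have vX2 : v \in X2 by apply: (subsetP sub2); apply: (subsetP sub1); rewrite !inE eqxx.
have := disjointFr dis vX2; rewrite inE vV /= => /negbT; rewrite negb_and !negbK.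
case/orP => h.
  have [s1 s2] := step _ h rv; apply: cov1 => //.
  by apply: disjointWl dis.
by have [s1 s2] := step _ h bv; apply: cov2.
Qed.

(** König's theorem is applied to the queries alone: they are independent in [P], so a matching
    among them has size at most [al]. The resulting cover hits every query, and the search tree then
    bounds what it misses in all of [V]. *)
Lemma robust_konig al :
  (forall Y : {set T}, Y \subset V -> independent P Y ->
     {in Y &, injective r} -> {in Y &, injective b} -> #|Y| <= al) ->
  exists S : {set I}, #|S| <= al /\ #|missed S| <= 2 ^ al.+1 * m.
Proof.
move=> bound.
(* Depth [al.+1] admits covers of size up to [al]. *)
have [|||X [_ XV iX _ cov]] := @search_tree (2 ^ al.+1) al.+1 set0 set0.
- exact: sub0set.
- by apply/forall_inP => x; rewrite inE.
- by rewrite cards0.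
have [Y [A [B [YX rinj binj /forall_inP cAB leY]]]] := konig r b X.
have leal : #|Y| <= al.
  apply: bound => //; first exact: subset_trans XV.
  apply/forall_inP => x xY; apply/forall_inP => y yY.
  by have /forall_inP/(_ _ (subsetP YX _ xY))/forall_inP/(_ _ (subsetP YX _ yY)) := iX.
have leS : #|A :|: B| <= al by rewrite cardsU; lia.
exists (A :|: B); split => //; apply: cov; rewrite ?sub0set ?setD0 //.
rewrite disjoint_subset; apply/subsetP => v /cAB; rewrite !inE => h.
by apply/negP => /and3P[_]; case/orP: h => ->; rewrite ?orbT //=.
Qed.

End RobustKonig.

(** * Monochromatic components and matchings inside them *)

Section Components.
Variables (T : finType) (E : {set {set T}}) (c : {set T} -> bool).
Hypothesis simpleE : simple_graph E.

(** The color tag keeps red and blue components apart, so that one set can hold components of both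
    colors. *)
Definition component (k : bool) (v : T) : bool * T :=
  (k, fingraph.root (adj (color_class E c k)) v).

Lemma edgeP (a : {set T}) : a \in E -> exists x y, x != y /\ a = [set x; y].
Proof. by move=> /(forall_inP simpleE)/cards2P. Qed.

Lemma adj_irrefl v : ~~ adj E v v.
Proof.
apply/negP => /(forall_inP simpleE).
by rewrite setUid cards1.
Qed.

Lemma connect_adj_sym k : connect_sym (adj (color_class E c k)).
Proof. by apply: sym_connect_sym; apply: adj_sym. Qed.

Lemma component_edge (a : {set T}) x y :
  a \in E -> x \in a -> y \in a -> component (c a) x = component (c a) y.
Proof.
move=> aE xa ya; have [-> // | xy] := eqVneq x y.
congr pair; apply/eqP; rewrite (root_connect (connect_adj_sym _)).
apply: connect1; rewrite /adj inE.
suff -> : [set x; y] = a by rewrite aE /=.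
apply/eqP; rewrite eqEcard subUset !sub1set xa ya cards2 xy.
by rewrite (eqP (forall_inP simpleE _ aE)).
Qed.

Definition edges_within (S : {set bool * T}) : {set {set T}} :=
  [set a in E | [forall x in a, component (c a) x \in S]].

Definition is_matching (S : {set bool * T}) (M : {set {set T}}) : bool :=
  (M \subset edges_within S) && trivIset M.

(** Otherwise the edge could be added to [M]. *)
Lemma maximal_matching_edge S M x y :
  maxset (is_matching S) M -> x \notin cover M -> y \notin cover M ->
  adj E x y -> component (c [set x; y]) x \notin S.
Proof.
move=> maxM xM yM xyE; have [/andP[MS trM] max] := maxsetP maxM.
apply/negP => xS; set a := [set x; y] in xS.
have aS : a \in edges_within S.
  have aE : a \in E := xyE.
  rewrite inE aE; apply/forall_inP => z za.
  by rewrite (component_edge aE za (_ : x \in a)) // !inE eqxx.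
have tr : trivIset (a |: M).
  apply: (proj1 (trivIsetU1 _ trM _)).
    move=> d dM; rewrite disjoint_subset; apply/subsetP => z.
    rewrite !inE => za; apply/negP => zd; have zM : z \in cover M by apply/bigcupP; exists d.
    by case/orP: za => /eqP ze; move: xM yM; rewrite -ze zM.
  apply/negP => /(subsetP MS); rewrite inE => /andP[/edgeP[u [v [_ /setP/(_ u)]]]].
  by rewrite !inE eqxx.
have := max (a |: M); rewrite /is_matching subUset sub1set aS MS tr subsetUr => /(_ isT isT) eM.
case/negP: xM; apply/bigcupP; exists a; last by rewrite !inE eqxx.
by rewrite -eM !inE eqxx.
Qed.

Lemma matching_partition S M : is_matching S M ->
  exists Q : {set {set T}}, [/\ partition Q (cover M), #|Q| <= #|S| &
    forall C, C \in Q -> spanned_by_matching E c C].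
Proof.
move=> /andP[/subsetP MS trM].
pose part s := [set a in M | [forall x in a, component (c a) x == s]].
have partP a x : a \in M -> x \in a -> a \in part (component (c a) x).
  move=> aM xa; have := MS _ aM; rewrite !inE aM => /andP[aE _] /=.
  by apply/forall_inP => y ya; rewrite (component_edge aE ya xa).
have coverP s x : x \in cover (part s) ->
    exists a, [/\ a \in M, x \in a & s = component (c a) x].
  case/bigcupP => a /[!inE] /andP[aM /forall_inP h] xa.
  by exists a; split; rewrite // (eqP (h x xa)).
(* Matching edges are grouped by their component in their own color; components without a matching
   edge would give empty classes. *)
exists ([set cover (part s) | s in S] :\ set0); split.
- apply/and3P; split; last by rewrite !inE eqxx.
    apply/eqP/setP => x; apply/bigcupP/bigcupP => [[C]|[a aM xa]].
      rewrite !inE => /andP[_ /imsetP[s _ ->]] /coverP[a [aM xa _]].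
      by exists a.
    have xC : x \in cover (part (component (c a) x)).
      by apply/bigcupP; exists a => //; apply: partP.
    exists (cover (part (component (c a) x))) => //; rewrite !inE.
    apply/andP; split; first by apply/set0Pn; exists x.
    by apply/imset_f; have /[!inE]/andP[_ /forall_inP/(_ x xa)] := MS _ aM.
  apply/trivIsetP => C1 C2 /[!inE] /andP[_ /imsetP[s1 _ ->]] /andP[_ /imsetP[s2 _ ->]] ne.
  rewrite disjoint_subset; apply/subsetP => x /coverP[a1 [a1M xa1 es1]].
  apply/negP => /coverP[a2 [a2M xa2 es2]]; case/eqP: ne.
  suff ea : a1 = a2 by rewrite es1 es2 ea.
  apply/eqP/contraT => nea; have := trivIsetP trM _ _ a1M a2M nea.
  by move/disjointFr/(_ xa1); rewrite xa2.
- by apply: leq_trans (leq_imset_card _ _); apply: subset_leq_card; apply: subD1set.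
move=> C /[!inE] /andP[_ /imsetP[s _ ->]]; exists (part s); split => //.
exists s.1; split.
- apply/subsetP => a /[!inE] /andP[aM /forall_inP h].
  have := MS _ aM; rewrite inE => /andP[aE _]; rewrite aE /=.
  have [x [y [_ ea]]] := edgeP aE.
  by rewrite -(eqP (h x _)) // ea !inE eqxx.
- by apply: trivIsetS trM; apply/subsetP => a /[!inE] /andP[].
exists s.2; apply/subsetP => x /coverP[a [_ _ ->]]; rewrite inE /=.
by rewrite connect_adj_sym connect_root.
Qed.

End Components.

(** * The partition under a bound on perturbed degrees *)

Section Partition.
Variables (T : finType) (E P : {set {set T}}) (c : {set T} -> bool).
Hypothesis simpleE : simple_graph E.
Hypothesis subPE : P \subset E.

Lemma independent_leq (S : {set T}) :
  independent E S -> #|S| <= independence_number E.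
Proof. by move=> iS; rewrite /independence_number (bigD1 S) //= leq_maxl. Qed.

Lemma unperturbed_simple : simple_graph (unperturbed E P).
Proof. by apply/forall_inP => a /setDP[aE _]; apply: (forall_inP simpleE). Qed.

Lemma perturbed_partition (V : {set T}) m :
  (forall v, v \in V -> #|[set w | adj P v w]| < m) ->
  exists (Z : {set T}) (Q : {set {set T}}),
    [/\ #|Z| <= #|~: V| + 3 * (2 ^ (independence_number E).+1 * m) + independence_number E,
        partition Q (~: Z), #|Q| <= 2 * independence_number E
      & forall C : {set T}, C \in Q -> good_class (unperturbed E P) c C].
Proof.
move=> degP; set al := independence_number E; set F := unperturbed E P.
have irrP v : ~~ adj P v v.
  by apply/negP => /(subsetP subPE); apply/negP; apply: adj_irrefl.
have simpleF : simple_graph F := unperturbed_simple.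
pose comp := component F c.
have comp_adj x y : adj F x y -> comp (c [set x; y]) x = comp (c [set x; y]) y.
  by move=> xyF; apply: component_edge; rewrite // !inE eqxx ?orbT.
(* Independence in both [P] and [F] amounts to independence in [E]. *)
have boundF (Y : {set T}) : independent P Y ->
    (forall x y, x \in Y -> y \in Y -> x != y -> ~~ adj F x y) -> #|Y| <= al.
  move=> iP h; apply: independent_leq; apply/forall_inP => x xY; apply/forall_inP => y yY.
  have [-> | xy] := eqVneq x y; first exact: adj_irrefl.
  have := h x y xY yY xy; rewrite /adj inE negb_and negbK.
  by have := forall_inP (forall_inP iP x xY) y yY; rewrite /adj => /negPf ->.
have [|S1 [leS1 miss1]] := @robust_konig T _ P V m (comp false) (comp true) irrP degP al.
  move=> Y _ iP inj0 inj1; apply: boundF => // x y xY yY xy; apply/negP => /comp_adj.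
  case: (c _) => [/(inj1 _ _ xY yY)|/(inj0 _ _ xY yY)] e; by rewrite e eqxx in xy.
have triv0 S : is_matching F c S set0.
  by rewrite /is_matching sub0set; apply/trivIsetP => a b; rewrite inE.
have [M1 max1 _] := maxset_exists (triv0 S1).
pose both (S : {set bool * T}) v := (comp false v \in S) && (comp true v \in S).
pose miss (S : {set bool * T}) v := (comp false v \notin S) && (comp true v \notin S).
pose L := [set v in V | [&& v \notin cover M1, ~~ miss S1 v & ~~ both S1 v]].
(* A vertex of [L] has exactly one component in [S1]; [key] picks the other. *)
pose key v := if comp false v \in S1 then comp true v else comp false v.
have degPL v : v \in L -> #|[set w | adj P v w]| < m by rewrite inE => /andP[/degP].
have key_other v k : v \in L -> comp k v \notin S1 -> key v = comp k v.
  rewrite inE /miss /both /key => /and4P[_ _].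
  by case: k; case: (_ \in S1); case: (_ \in S1).
(* With [key] on both sides, a cover is just a set of labels. An edge of [F] inside [L] avoids [M1],
   so its component lies outside [S1] and is the label of both ends. *)
have [|S2 [leS2 miss2]] := @robust_konig T _ P L m key key irrP degPL al.
  move=> Y YL iP inj _; apply: boundF => // x y xY yY xy; apply/negP => xyF.
  have xL := subsetP YL _ xY; have yL := subsetP YL _ yY.
  have /[!inE]/and4P[_ xM _ _] := xL; have /[!inE]/and4P[_ yM _ _] := yL.
  have nS := maximal_matching_edge simpleF max1 xM yM xyF.
  have := comp_adj _ _ xyF; rewrite -(key_other x) // -key_other //; last first.
    by rewrite -comp_adj.
  by move/(inj _ _ xY yY) => e; rewrite e eqxx in xy.
have m1 : is_matching F c (S1 :|: S2) M1.
  have [/andP[sub tr] _] := maxsetP max1; rewrite /is_matching tr andbT.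
  apply: subset_trans sub _; apply/subsetP => a /[!inE] /andP[-> /forall_inP h] /=.
  by apply/forall_inP => x /h; rewrite inE => ->.
have [M max2 M1M] := maxset_exists m1.
have [Q [pQ leQ goodQ]] := matching_partition simpleF (maxsetp max2).
pose U := [set v in V | (v \notin cover M) && both (S1 :|: S2) v].
(* Here each vertex is its own label, so [S3] is a set of at most [al] vertices and the missed
   points are those of [U] outside [S3]. *)
have [||S3 [leS3 miss3]] := @robust_konig T _ P U m id id irrP _ al.
- by move=> v; rewrite inE => /andP[/degP].
- move=> Y YU iP _ _; apply: boundF => // x y xY yY xy; apply/negP => xyF.
  have /[!inE]/and3P[_ xM /andP[x0 x1]] := subsetP YU _ xY.
  have /[!inE]/and3P[_ yM _] := subsetP YU _ yY.
  have /negP := maximal_matching_edge simpleF max2 xM yM xyF; apply.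
  by case: (c _).
exists (~: cover M), Q; rewrite setCK; split => //; last 2 first.
- by apply: leq_trans leQ (leq_trans (leq_card_setU _ _) _); rewrite mul2n -addnn leq_add.
- by move=> C /goodQ; constructor 1.
set miss_1 := missed _ _ _ _ in miss1.
set miss_2 := missed _ _ _ _ in miss2.
set miss_3 := missed _ _ _ _ in miss3.
(* An uncovered vertex of [V] with no component in [S1] is in [miss_1]. With exactly one it is in
   [L], hence in [miss_2] unless its label is in [S2]. In all remaining cases it is in [U], hence in
   [miss_3] or [S3]. *)
have sub : ~: cover M \subset ~: V :|: miss_1 :|: miss_2 :|: miss_3 :|: S3.
  apply/subsetP => v; rewrite in_setC => vM; rewrite !in_setU in_setC.
  case vV : (v \in V) => //=.
  have vM1 : v \notin cover M1.
    apply: contra vM => /bigcupP[a aM va]; apply/bigcupP; exists a => //.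
    exact: (subsetP M1M).
  rewrite !inE vV vM vM1 /miss /both /key /= !inE.
  by case: (comp false v \in S1); case: (comp true v \in S1);
     case: (comp false v \in S2); case: (comp true v \in S2); case: (v \in S3).
apply: leq_trans (subset_leq_card sub) _.
rewrite !mulSn mul0n addn0 !addnA; do 4 (apply: leq_trans (leq_card_setU _ _) _; apply: leq_add => //).
Qed.

End Partition.

(** * Counting perturbed degrees, and the theorem *)

Lemma sum_degree (T : finType) (P : {set {set T}}) :
  simple_graph P -> \sum_(v : T) #|[set w | adj P v w]| <= 2 * #|P|.
Proof.
move=> /forall_inP simpleP.
have -> : 2 * #|P| = \sum_(v : T) #|[set a in P | v \in a]|.
  under eq_bigr => v _ do rewrite -sum1dep_card.
  rewrite (exchange_big_dep (mem P)) /=; last by move=> v a _ /andP[].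
  rewrite mulnC -sum_nat_const; apply: eq_bigr => a aP.
  rewrite -(eqP (simpleP a aP)) -sum1_card; apply: eq_bigl => v.
  by rewrite aP.
apply: leq_sum => v _.
rewrite -(card_in_imset (f := fun w => [set v; w])); last first.
  move=> x y; rewrite !inE => vx vy /setP exy.
  have := simpleP _ vx; rewrite cards2; have [//|vx' _] := eqVneq v x.
  by have := exy x; rewrite !inE eqxx orbT eq_sym (negPf vx') /= => /esym/eqP.
apply: subset_leq_card; apply/subsetP => a /imsetP[w]; rewrite inE /adj => vw ->.
by rewrite inE vw !inE eqxx.
Qed.

Local Open Scope ring_scope.

Theorem theorem15 (R : realType) :
  exists f : nat -> R,
    (forall k : nat, 0 < f k) /\
    forall (eps : R) (T : finType) (E P : {set {set T}}) (c : {set T} -> bool),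
      0 < eps ->
      simple_graph E ->
      perturbed eps E P ->
      (Num.sqrt eps)^-1 <= #|T|%:R ->
      exists (Z : {set T}) (Q : {set {set T}}),
        [/\ #|Z|%:R <= (f (independence_number E) + (independence_number E)%:R)
                         * Num.sqrt eps * #|T|%:R,
            partition Q (~: Z),
            (#|Q| <= 2 * independence_number E)%N
          & forall C : {set T}, C \in Q -> good_class (unperturbed E P) c C].
Proof.
(* With at most [D] discarded vertices and [m = D.+1 <= 2 * D], the three losses sum to at most [3 *
   2 ^ al.+1 * (2 * D) = 12 * 2 ^ al * D]. *)
exists (fun k => (1 + 12 * 2 ^ k)%N%:R); split=> [k|eps T E P c eps0 simE [PE leP] n_ge].
  by rewrite ltr0n.
set al := independence_number E.
pose d : R := Num.sqrt eps * #|T|%:R.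
have s0 : 0 < Num.sqrt eps by rewrite sqrtr_gt0.
(* The lower bound on the number of vertices yields [D >= 1], which is what allows [D.+1 <= 2 * D]
   and [al <= al * D]. *)
have d1 : 1 <= d by rewrite /d -[leLHS](mulfV (lt0r_neq0 s0)) ler_pM2l.
have simP : simple_graph P.
  by apply/forall_inP => a /(subsetP PE) aE; apply: (forall_inP simE).
pose D := Num.truncn d.
have /andP[Dd dD] : D%:R <= d < D.+1%:R.
  by apply: Num.Theory.truncn_itv; apply: le_trans d1; apply: ler01.
have D0 : (0 < D)%N by rewrite Num.Theory.truncn_gt0.
pose V := [set v : T | (#|[set w | adj P v w]| <= D)%N].
have leV : (#|~: V| * D.+1 <= 2 * #|P|)%N.
  apply: leq_trans (sum_degree simP); rewrite -sum_nat_const.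
  rewrite [leqRHS](bigID (mem (~: V))) /= -[leqLHS]addn0 leq_add // leq_sum // => v.
  by rewrite !inE -ltnNge.
have le2P : (2 * #|P|)%:R <= d ^+ 2.
  rewrite natrM; apply: le_trans (_ : 2 * (eps * 'C(#|T|, 2)%:R) <= _).
    by rewrite ler_pM2l.
  rewrite /d exprMn (sqr_sqrtr (ltW eps0)) mulrCA ler_pM2l // -natrM -natrX ler_nat.
  rewrite bin2 mul2n.
  apply: leq_trans (_ : (#|T| * #|T|.-1 <= _)%N); first by rewrite -[leqRHS]odd_double_half leq_addl.
  by rewrite -mulnn leq_mul2l leq_pred orbT.
(* The perturbed degrees sum to at most d ^ 2, so at most d of them exceed d. *)
have leVD : (#|~: V| <= D)%N.
  rewrite -ltnS -(ltr_nat R); apply: le_lt_trans (dD).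
  have d0 : 0 < d by apply: lt_le_trans d1.
  rewrite -(ler_pM2r d0) -expr2; apply: le_trans le2P.
  apply: le_trans (_ : (#|~: V| * D.+1)%:R <= _); last by rewrite ler_nat.
  by rewrite natrM ler_wpM2l ?ler0n // (ltW dD).
have [v|Z [Q [leZ pQ leQ goodQ]]] := perturbed_partition c simE PE (V := V) (m := D.+1).
  by rewrite inE ltnS.
exists Z, Q; split => //.
rewrite -mulrA -/d -natrD; apply: le_trans (_ : ((1 + 12 * 2 ^ al + al) * D)%:R <= _).
  rewrite ler_nat; apply: leq_trans leZ _; rewrite -/al expnS.
  move: leVD D0; move: #|~: V| (D) (2 ^ al)%N => z D' q; clear; nia.
by rewrite natrM ler_wpM2l ?ler0n.
Qed.
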